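(* Let $p\in[0,\tfrac23)$ and let $\mathcal{G}_p$ be the class of trees $G$ with $\frac{n_2}{n'}=p$, where $n'$ is the number of non-leaf vertices of $G$ and $n_2$ is the number of vertices of degree $2$. Then there is a constant $N_p>0$ such that every tree in $\mathcal{G}_p$ with at least $N_p$ non-leaf vertices is well-burnable.
   Context: Burning process on a graph $G$: in round 1 one vertex is chosen and set on fire; in each subsequent round, first every burning vertex sets all its neighbours on fire, then one new vertex is chosen and set on fire; the process ends when all vertices are on fire. The burning number $b(G)$ is the minimum number of rounds needed. A graph on $n$ vertices is well-burnable if $b(G)\le\lceil\sqrt n\,\rceil$. *)

(* Defs.v *)
From mathcomp Require Import all_boot all_order all_algebra.
From mathcomp Require Import all_reals.

Set Implicit Arguments.
Unset Strict Implicit.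
Unset Printing Implicit Defensive.

Import Order.TTheory GRing.Theory Num.Theory.

Section Graphs.

Variables (T : finType) (e : rel T).

Definition simple_graph : Prop := symmetric e /\ irreflexive e.

(* In a symmetric irreflexive relation, [ucycle e [:: x; y]] holds for every
   edge, so the cycles of the graph are the [ucycle]s of size at least 3. *)
Definition acyclic : Prop := forall c : seq T, ucycle e c -> size c < 3.

Definition connected : Prop := 0 < #|T| /\ forall x y : T, connect e x y.

Definition tree : Prop := [/\ simple_graph, connected & acyclic].

Definition degree (x : T) : nat := #|[set y | e x y]|.

Definition leaf (x : T) : bool := degree x == 1.

Definition num_nonleaf : nat := #|[set x | ~~ leaf x]|.

Definition num_deg2 : nat := #|[set x | degree x == 2]|.

Definition spread (A : {set T}) : {set T} :=
  A :|: [set y | [exists x in A, e x y]].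

(* [burn_round A B]: a round played while [A], not yet everything, is on fire
   can end with [B] on fire. The chosen vertex must not be burning already; if
   spreading leaves no such vertex, the round consists of the spreading only.
   As [spread set0 = set0], round 1 is a [burn_round] from [set0]. *)
Definition burn_round (A B : {set T}) : bool :=
  (A != setT) &&
  (if spread A == setT then B == setT
   else [exists x, (x \notin spread A) && (B == x |: spread A)]).

(* [s] lists the sets of vertices on fire at the end of the successive rounds. *)
Definition burning_process (s : seq {set T}) : bool :=
  path burn_round set0 s && (last set0 s == setT).

Definition burns_in (k : nat) : bool :=
  [exists s : k.-tuple {set T}, burning_process s].

Lemma burns_in_ex : exists k, burns_in k.
Proof.
suff: forall m (A : {set T}), #|~: A| <= m ->
    exists s, path burn_round A s && (last A s == setT).
  case/(_ _ set0 (leqnn _)) => s bs.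
  by exists (size s); apply/existsP; exists (in_tuple s).
elim=> [|m IHm] A leAm.
  exists [::]; move: leAm; rewrite leqn0 cards_eq0 => /eqP A0 /=.
  by rewrite -(setCK A) A0 setC0.
have [->|A_neqT] := eqVneq A setT; first by exists [::]; rewrite /= eqxx.
have [spT|sp_neqT] := eqVneq (spread A) setT.
  by exists [:: setT]; rewrite /= /burn_round A_neqT spT !eqxx.
have [x xP] : exists x, x \notin spread A.
  apply/existsP; rewrite -negb_forall; apply: contra sp_neqT => /forallP spA.
  by apply/eqP/setP=> y; rewrite spA inE.
have xA : x \notin A by apply: contra xP => xA; rewrite inE xA.
have [|s /andP[ps ls]] := IHm (x |: spread A).
  rewrite -ltnS; apply: leq_trans leAm; apply: proper_card.
  apply/properP; split; last by exists x; rewrite !inE ?eqxx.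
  by rewrite setCS; apply/subsetP=> y yA; rewrite !inE yA !orbT.
exists (x |: spread A :: s); rewrite /= ps ls !andbT /burn_round A_neqT.
by rewrite (negPf sp_neqT); apply/existsP; exists x; rewrite xP eqxx.
Qed.

Definition burning_number : nat := ex_minn burns_in_ex.

Definition well_burnable (R : realType) : Prop :=
  ((burning_number%:Z)%R <= Num.ceil (Num.sqrt (#|T|%:R : R)))%R.

Definition in_class (R : realType) (p : R) : Prop :=
  tree /\ (num_deg2%:R / num_nonleaf%:R = p :> R)%R.

End Graphs.

(* Main.v *)
Require Import Defs.
From mathcomp Require Import all_boot all_order all_algebra.
From mathcomp Require Import all_reals.
From mathcomp Require Import zify ring lra.

(** Counting degrees, a tree in the class has about [(2 - p) n'] vertices or
    more, with [2 - p > 4 / 3], and burning all non-leaf vertices burns the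
    leaves one round later. So it suffices to cover an ancestor-closed set of
    [n'] vertices of a rooted tree by balls of distinct radii smaller than
    [(1 + o(1)) sqrt (4 n' / 3)].

    Let [v_0] be a deepest vertex, with ancestors [v_1, v_2, ...], and let
    [f j] be the height of the branches that meet this spine in [v_j]. The ball
    of radius [s] around [v_s] contains everything below [v_i], where [i > s] is
    the first index with [f i + i > 2 * s]; this part can be cut off. If [c s] is
    its size, then [c 1 + ... + c k] is at least the sum of the [minn (2 * s) k],
    about [3 k ^ 2 / 4]: a high branch stops few radii early, but it is itself
    removed by all larger radii.

    Since this bound on the sum holds for every remaining tree, multiplicative
    weights on blocks of nearly equal radii select the radii to be used in such
    a way that no block is exhausted before the whole tree is covered. *)

Set Implicit Arguments.
Unset Strict Implicit.
Unset Printing Implicit Defensive.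

Import Order.TTheory GRing.Theory Num.Theory.

(** * Burning as covering by balls of distinct radii *)

Section Balls.

Variables (T : finType) (e : rel T).

Definition ball (u : T) (s : nat) : {set T} := iter s (spread e) [set u].

Lemma sub_spread (A : {set T}) : A \subset spread e A.
Proof. exact: subsetUl. Qed.

Lemma spreadS (A B : {set T}) : A \subset B -> spread e A \subset spread e B.
Proof.
move=> AB; apply/subsetP=> y; rewrite !inE => /orP[/(subsetP AB) -> //|].
case/existsP=> x /andP[/(subsetP AB) xB exy].
by apply/orP; right; apply/existsP; exists x; rewrite xB.
Qed.

Lemma ball_step (u : T) (s : nat) (y z : T) :
  y \in ball u s -> e y z -> z \in ball u s.+1.
Proof.
move=> yu eyz; rewrite /= !inE; apply/orP; right.
by apply/existsP; exists y; rewrite -/(ball u s) yu.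
Qed.

Lemma ballS (u : T) (s s' : nat) : s <= s' -> ball u s \subset ball u s'.
Proof.
elim: s' => [|s' IH]; first by rewrite leqn0 => /eqP->.
rewrite leq_eqVlt ltnS => /orP[/eqP-> //|/IH sub].
exact: subset_trans sub (sub_spread _).
Qed.

(* With [j] rounds left, the fire that ends with radius [i >= j] has radius
   [i - j]. *)
Lemma burning_path_exists (K : nat) (u : nat -> T) :
  (forall y, exists2 i, i < K & y \in ball (u i) i) ->
  forall j (A : {set T}),
  (forall i, j <= i < K -> ball (u i) (i - j) \subset A) ->
  exists s, [/\ size s <= j, path (burn_round e) A s & last A s == setT].
Proof.
move=> cov; elim=> [|j IH] A subA.
  exists [::]; split=> //=; rewrite -subTset; apply/subsetP=> y _.
  have [i iK yi] := cov y.
  by apply: (subsetP (subA i _)); rewrite ?iK ?subn0.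
have [->|A_neqT] := eqVneq A setT; first by exists [::]; rewrite /= eqxx.
have [spT|sp_neqT] := eqVneq (spread e A) setT.
  by exists [:: setT]; rewrite /= /burn_round A_neqT spT !eqxx.
(* If [u j] already burns, the rules demand another vertex, and any fresh one will do. *)
have [x xP ujP] : exists2 x, x \notin spread e A & u j \in x |: spread e A.
  have [uj|uj] := boolP (u j \in spread e A); last by exists (u j); rewrite ?setU11.
  have /existsP[x xP] : [exists x, x \notin spread e A].
    rewrite -negb_forall; apply: contra sp_neqT => /forallP spA.
    by apply/eqP/setP=> y; rewrite spA inE.
  by exists x => //; rewrite inE uj orbT.
have [i /andP[ji iK]|s [sz ps ls]] := IH (x |: spread e A).
  have [->|ij] := eqVneq i j; first by rewrite subnn sub1set.
  have ji' : j < i by rewrite ltn_neqAle eq_sym ij.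
  have -> : i - j = (i - j.+1).+1 by lia.
  apply: subset_trans (subsetUr _ _); apply: spreadS.
  by apply: subA; rewrite ji' iK.
exists (x |: spread e A :: s); split=> //=; rewrite ps andbT /burn_round A_neqT.
by rewrite (negPf sp_neqT); apply/existsP; exists x; rewrite xP eqxx.
Qed.

Lemma burning_number_le_cover (K : nat) (u : nat -> T) :
  (forall y, exists2 i, i < K & y \in ball (u i) i) -> burning_number e <= K.
Proof.
move=> cov.
have [i /andP[Ki iK]|s [sz ps ls]] := burning_path_exists cov (j := K) (A := set0).
  by move: iK; rewrite ltnNge Ki.
apply: leq_trans sz; rewrite /burning_number; case: ex_minnP => k _; apply.
by apply/existsP; exists (in_tuple s); rewrite /burning_process ps.
Qed.

End Balls.

(** * Sums over radii *)

Lemma sum_indicator_double (l f n : nat) :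
  \sum_(s < n) (l <= 2 * s.+1 < f + l) <= f.
Proof.
(* The second bound makes the induction go through: it is how far the next even number lies beyond
   [l]. *)
suff: \sum_(s < n) (l <= 2 * s.+1 < f + l) <= minn f (2 * n.+1 - l) by lia.
elim: n => [|n IH]; first by rewrite big_ord0.
rewrite big_ord_recr; move: IH; set X := \sum_(_ < n) _.
by case: (boolP (l <= _ < _)); rewrite /=; lia.
Qed.

(** Double counting: [f l] occurs on the right for every [s < k] with [l <= s.+1], hence at least
    [k - l] times. *)
Lemma sum_prefix_sums (f : nat -> nat) (k : nat) :
  \sum_(l < k) f l * (k - l) <= \sum_(s < k) \sum_(l < s.+2) f l.
Proof.
elim: k => [|k IH]; first by rewrite !big_ord0.
rewrite [leqRHS]big_ord_recr /=.
have -> : \sum_(l < k.+1) f l * (k.+1 - l) =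
          \sum_(l < k) f l * (k - l) + \sum_(l < k.+1) f l.
  rewrite !big_ord_recr /= subSnn muln1 addnA -big_split /=; congr (_ + _).
  by apply: eq_bigr => l _; rewrite subSn ?mulnS 1?addnC // ltnW.
apply: leq_add => //; rewrite [leqRHS]big_ord_recr /=; exact: leq_addr.
Qed.

(* A radius [s] whose removal stops early, at [i s < minn (2 * s) k], loses at
   most [k - i s]; at most [f l] radii stop at [l], whereas each of the [k - l]
   radii larger than [l] gains [f l]. *)
Lemma sum_removed (k : nat) (f i : nat -> nat) :
  (forall s, s <= k -> s < i s) ->
  (forall s, s <= k -> 2 * s < f (i s) + i s) ->
  \sum_(s < k) minn (2 * s.+1) k <=
  \sum_(s < k) (i s.+1 + \sum_(l < i s.+1) f l).
Proof.
move=> lt_i stop_i.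
pose L (s l : nat) := (l == i s.+1) && (l <= 2 * s.+1).
have le1 (s : 'I_k) : minn (2 * s.+1) k <= i s.+1 + \sum_(l < k) L s l * (k - l).
  have [ik|] := ltnP (i s.+1) k; last by lia.
  rewrite (bigD1 (Ordinal ik)) //= /L eqxx /=; lia.
apply: (@leq_trans (\sum_(s < k) (i s.+1 + \sum_(l < k) L s l * (k - l)))).
  by apply: leq_sum => s _; apply: le1.
rewrite !big_split /= leq_add2l exchange_big /=.
apply: (@leq_trans (\sum_(l < k) f l * (k - l))).
  apply: leq_sum => l _; rewrite -big_distrl /= leq_mul2r; apply/orP; right.
  apply: leq_trans (sum_indicator_double l (f l) k); apply: leq_sum => s _.
  (* The double of every radius that stops at [l] is less than [f l + l]. *)
  have := stop_i s.+1 (ltn_ord s); rewrite /L; case: eqP => // <- ->.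
  by rewrite andbT.
apply: leq_trans (sum_prefix_sums f k) _; apply: leq_sum => s _.
have := lt_i s.+1 (ltn_ord s) => lt.
rewrite -(big_mkord xpredT f) -(big_mkord xpredT f) (big_cat_nat (leq0n _) lt) /=.
exact: leq_addr.
Qed.

(** The first [q] terms are 2, 4, ..., 2q, with sum q (q + 1); the other [q] terms all equal 2q. *)
Lemma sum_minn_double (q : nat) :
  3 * q ^ 2 <= \sum_(s < q + q) minn (2 * s.+1) (q + q).
Proof.
rewrite big_split_ord /=.
have -> : \sum_(s < q) minn (2 * s.+1) (q + q) = q * q.+1.
  have -> : \sum_(s < q) minn (2 * s.+1) (q + q) = \sum_(s < q) 2 * s.+1.
    by apply: eq_bigr => s _; have := ltn_ord s; lia.
  elim: q => [|q IH]; first by rewrite big_ord0.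
  by rewrite big_ord_recr /= IH; lia.
have -> : \sum_(s < q) minn (2 * (q + s).+1) (q + q) = \sum_(s < q) (q + q).
  by apply: eq_bigr => s _; lia.
rewrite sum_nat_const card_ord; nia.
Qed.

(** Every radius is rounded up to a multiple of [m], which is the least radius of a block in
    [available] below. *)
Lemma sum_blocks (c : nat -> nat) (m B : nat) :
  (forall s s', s <= s' <= B * m -> c s <= c s') ->
  \sum_(s < B * m) c s.+1 <= m * \sum_(b < B) c (b.+1 * m).
Proof.
elim: B => [|B IH] mono_c; first by rewrite !big_ord0.
rewrite [B.+1 * m]mulSn addnC big_split_ord /= [\sum_(b < B.+1) _]big_ord_recr /=.
rewrite mulnDr leq_add //.
  by apply: IH => s s' ss'; apply: mono_c; lia.
apply: (@leq_trans (\sum_(s < m) c (B.+1 * m))); last by rewrite sum_nat_const card_ord.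
by apply: leq_sum => s _; apply: mono_c; have := ltn_ord s; lia.
Qed.

(** * Rooted trees and peeling along a spine *)

Definition rooted (T : finType) (e : rel T) (par : T -> T) (dep : T -> nat) :=
  [/\ forall x y, dep x = 0 -> dep y = 0 -> x = y,
      forall y, dep (par y) = (dep y).-1 &
      forall y, 0 < dep y -> e (par y) y && e y (par y)].

Definition par_closed (T : finType) (par : T -> T) (S : {set T}) :=
  {in S, forall y, par y \in S}.

Section Peeling.

Variables (T : finType) (e : rel T) (par : T -> T) (dep : T -> nat).
Hypothesis rootedT : rooted e par dep.

Let root_uniq : forall x y, dep x = 0 -> dep y = 0 -> x = y.
Proof. by case: rootedT. Qed.

Let dep_par : forall y, dep (par y) = (dep y).-1.
Proof. by case: rootedT. Qed.

Lemma dep_iter_par (a : nat) (y : T) : dep (iter a par y) = dep y - a.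
Proof. by elim: a => [|a IH] /=; rewrite ?subn0 // dep_par IH -subnS. Qed.

(** As [0.-1 = 0], uniqueness of the root makes it its own parent, so iterating [par] too often is
    harmless. *)
Lemma par_root (y : T) : dep y = 0 -> par y = y.
Proof. by move=> y0; apply: root_uniq; rewrite ?dep_par y0. Qed.

Lemma ball_iter_down (u y : T) (a s : nat) :
  iter a par y \in ball e u s -> y \in ball e u (a + s).
Proof.
elim: a y => // a IH y; rewrite iterSr addSn => /IH py.
have [y0|y0] := posnP (dep y).
  by move: py; rewrite par_root //; apply/subsetP/ballS.
by apply: ball_step py _; case: rootedT => _ _ /(_ y y0) /andP[].
Qed.

Lemma ball_iter_up (u : T) (a : nat) : iter a par u \in ball e u a.
Proof.
elim: a => [|a IH]; first by rewrite inE.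
rewrite iterS; have [y0|y0] := posnP (dep (iter a par u)).
  by rewrite par_root //; apply: (subsetP (ballS _ _ (leqnSn a))).
by apply: ball_step IH _; case: rootedT => _ _ /(_ _ y0) /andP[].
Qed.

Lemma iter_par_in (S : {set T}) (a : nat) (y : T) :
  par_closed par S -> y \in S -> iter a par y \in S.
Proof. by move=> clS yS; elim: a => //= a; apply: clS. Qed.

Section Meet.

Variable x : T.
Local Notation h := (dep x).

(* [iter l par x] is an ancestor of [y]. If [y] is too high for that, the
   truncated subtraction is [0] and the depths of the two sides differ. *)
Definition above (l : nat) (y : T) : bool :=
  iter (dep y - (h - l)) par y == iter l par x.

Lemma above_top (y : T) : above h y.
Proof.
apply/eqP/root_uniq; rewrite dep_iter_par; lia.
Qed.

Lemma above_ex (y : T) : exists l, above l y.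
Proof. by exists h; apply: above_top. Qed.

(** The lowest common ancestor of [x] and [y], given by its distance from [x]. *)
Definition meet (y : T) : nat := ex_minn (above_ex y).

Lemma meetP (y : T) : above (meet y) y.
Proof. by rewrite /meet; case: ex_minnP. Qed.

Lemma meet_min (y : T) (l : nat) : above l y -> meet y <= l.
Proof. by rewrite /meet; case: ex_minnP => m _; apply. Qed.

Lemma meet_le (y : T) : meet y <= h.
Proof. exact: meet_min (above_top y). Qed.

Lemma above_dep (l : nat) (y : T) : l <= h -> above l y -> h - l <= dep y.
Proof. by move=> lh /eqP/(congr1 dep); rewrite !dep_iter_par; lia. Qed.

Lemma above_up (l l' : nat) (y : T) : l <= l' <= h -> above l y -> above l' y.
Proof.
move=> /andP[ll' l'h] al; have := above_dep (leq_trans ll' l'h) al => dy.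
move/eqP: al => al; apply/eqP.
have -> : dep y - (h - l') = (l' - l) + (dep y - (h - l)) by lia.
by rewrite iterD al -iterD subnK.
Qed.

Lemma meet_par (y : T) : meet y <= meet (par y).
Proof.
have [y0|y0] := posnP (dep y); first by rewrite par_root.
apply: meet_min; have := meetP (par y) => al.
have := above_dep (meet_le _) al; rewrite dep_par => dy.
move/eqP: al; rewrite dep_par => al; apply/eqP; rewrite -al -iterSr.
by congr (iter _ _ _); lia.
Qed.

Lemma meet_iter_par (a : nat) (y : T) :
  a <= dep y - (h - meet y) -> meet (iter a par y) = meet y.
Proof.
move=> ad; apply/eqP; rewrite eqn_leq; apply/andP; split; last first.
  by elim: {ad}a => //= a /leq_trans; apply; apply: meet_par.
apply: meet_min; have al := meetP y; have dy := above_dep (meet_le y) al.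
move/eqP: al => al; apply/eqP; rewrite -al dep_iter_par -iterD.
by congr (iter _ _ _); lia.
Qed.

Lemma meet_spine (l : nat) : l <= h -> meet (iter l par x) = l.
Proof.
move=> lh; have al : above l (iter l par x).
  by rewrite /above dep_iter_par subnn.
apply/eqP; rewrite eqn_leq meet_min //=.
have := above_dep (meet_le _) (meetP (iter l par x)); rewrite dep_iter_par.
by have := meet_le (iter l par x); lia.
Qed.

Variable S : {set T}.

Definition shell (l : nat) : {set T} := [set y in S | meet y == l].

Definition branch (l : nat) : nat := \max_(y in shell l) (dep y - (h - l)).

Lemma stop_ex (s : nat) : exists j, (s < j) && (2 * s < branch j + j).
Proof. by exists (2 * s).+1; lia. Qed.

(** The search may run past the top of the spine, where shells are empty; if [stop s] exceeds [h],
    then [removed s] is all of [S]. *)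
Definition stop (s : nat) : nat := ex_minn (stop_ex s).

Lemma stopP (s : nat) : (s < stop s) && (2 * s < branch (stop s) + stop s).
Proof. by rewrite /stop; case: ex_minnP. Qed.

Lemma stop_min (s j : nat) : s < j -> 2 * s < branch j + j -> stop s <= j.
Proof.
by rewrite /stop; case: ex_minnP => m _ min_m sj br; apply: min_m; rewrite sj.
Qed.

Lemma stop_mono (s s' : nat) : s <= s' -> stop s <= stop s'.
Proof. by move=> ss'; have /andP[? ?] := stopP s'; apply: stop_min; lia. Qed.

Definition removed (s : nat) : {set T} := [set y in S | meet y < stop s].

Lemma removed_mono (s s' : nat) : s <= s' -> #|removed s| <= #|removed s'|.
Proof.
move=> ss'; apply/subset_leq_card/subsetP=> y; rewrite !inE => /andP[-> /=].
by move/leq_trans; apply; apply: stop_mono.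
Qed.

Hypothesis x_deepest : {in S, forall y, dep y <= h}.

(** If [meet y <= s], then [y] lies below the centre, by at most [s] since [x] is deepest. Otherwise
    the search did not stop at [meet y], and the way up the spine and down the branch has length at
    most [branch (meet y) + meet y - s <= s]. *)
Lemma removed_ball (s : nat) :
  s <= h -> removed s \subset ball e (iter s par x) s.
Proof.
move=> sh; apply/subsetP=> y; rewrite inE => /andP[yS my].
have yh := x_deepest yS.
have [ms|sm] := leqP (meet y) s.
  have al : above s y by apply: above_up (meetP y); rewrite ms.
  have dy := above_dep sh al.
  apply: (subsetP (ballS _ _ _))
    (ball_iter_down (a := dep y - (h - s)) (s := 0) _); last first.
    by move/eqP: al => ->; rewrite inE.
  by lia.
have br : branch (meet y) + meet y <= 2 * s.
  by rewrite leqNgt; apply/negP=> /(stop_min sm); rewrite leqNgt my.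
have db : dep y - (h - meet y) <= branch (meet y).
  by apply: (leq_bigmax_cond (F := fun y0 => _ - _)); rewrite inE yS eqxx.
apply: (subsetP (ballS _ _ _))
  (ball_iter_down (a := dep y - (h - meet y)) (s := meet y - s) _); last first.
  have /eqP-> := meetP y; rewrite -[in iter (meet y)](subnK (ltnW sm)) iterD.
  exact: ball_iter_up.
by lia.
Qed.

Hypotheses (clS : par_closed par S) (xS : x \in S).

(** The path from a deepest vertex of the shell up to the spine stays in the shell. *)
Lemma card_shell (l : nat) : l <= h -> branch l < #|shell l|.
Proof.
move=> lh; have vl : iter l par x \in shell l.
  by rewrite inE meet_spine // eqxx andbT iter_par_in.
have [|y] := @eq_bigmax_cond _ (mem (shell l)) (fun y => dep y - (h - l)).
  by apply/card_gt0P; exists (iter l par x).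
rewrite /= -/(branch l) => /setIdP[yS /eqP myl] br.
pose g (a : 'I_(branch l).+1) := iter a par y.
have g_inj : injective g.
  move=> a b /(congr1 dep); rewrite !dep_iter_par => ab; apply: val_inj => /=.
  by have := ltn_ord a; have := ltn_ord b; lia.
rewrite -[(branch l).+1]card_ord -cardsT -(card_imset _ g_inj).
apply/subset_leq_card/subsetP=> _ /imsetP[a _ ->]; rewrite inE iter_par_in //=.
by rewrite meet_iter_par ?myl // -br -ltnS.
Qed.

(** Since [meet] never decreases towards the root, peeling can be repeated on what is left. *)
Lemma removed_closed (s : nat) : par_closed par (S :\: removed s).
Proof.
move=> y; rewrite !inE => /andP[+ yS]; rewrite yS /= -leqNgt => my.
by rewrite clS //= -leqNgt (leq_trans my (meet_par y)).
Qed.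

Lemma card_removed (s : nat) :
  stop s <= h -> stop s + \sum_(l < stop s) branch l <= #|removed s|.
Proof.
move=> sh; have -> : #|removed s| = \sum_(l < stop s) #|shell l|.
  rewrite /removed; elim: (stop s) => [|j IH].
    by rewrite big_ord0; apply: eq_card0 => y; rewrite inE andbF.
  have disj : [set y in S | meet y < j] :&: shell j = set0.
    by apply/setP=> y; rewrite !inE; case: ltngtP; rewrite ?andbF.
  rewrite big_ord_recr /= -IH -cardsUI disj cards0 addn0.
  by apply: eq_card => y; rewrite !inE ltnS leq_eqVlt orbC andb_orr.
rewrite -[X in X + _]card_ord -sum1_card -big_split /=.
apply: leq_sum => l _; rewrite add1n; apply: card_shell.
by apply: leq_trans sh; apply: ltnW.
Qed.

End Meet.

(** One ball suffices if the spine has length at most [k] or the search for radius [k] leaves it.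
    Otherwise all searches up to radius [k] stop on the spine, where [card_removed] applies. *)
Lemma peel (S : {set T}) (k : nat) : par_closed par S -> S != set0 ->
  (exists u, S \subset ball e u k) \/
  exists (D : nat -> {set T}) (u : nat -> T),
  [/\ forall s, par_closed par (S :\: D s),
      forall s, s <= k -> D s \subset S :&: ball e (u s) s,
      forall s s', s <= s' -> #|D s| <= #|D s'| &
      \sum_(s < k) minn (2 * s.+1) k <= \sum_(s < k) #|D s.+1|].
Proof.
move=> clS /set0Pn[x0 x0S].
have [x xS x_deepest] : exists2 x, x \in S & {in S, forall y, dep y <= dep x}.
  by case: (arg_maxnP dep x0S) => x xS max_x; exists x => // y /max_x.
have [hk|kh] := leqP (dep x) k.
  left; exists (iter (dep x) par x); apply/subsetP=> y yS.
  have yh := x_deepest y yS; apply: (subsetP (ballS _ _ (leq_trans yh hk))).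
  rewrite -[dep y]addn0; apply: ball_iter_down.
  have -> : iter (dep y) par y = iter (dep x) par x.
    by apply: root_uniq; rewrite dep_iter_par subnn.
  by rewrite inE.
have [hs|sh] := ltnP (dep x) (stop x S k).
  left; exists (iter k par x); apply: subset_trans (removed_ball x_deepest (ltnW kh)).
  by apply/subsetP=> y yS; rewrite inE yS (leq_ltn_trans (meet_le x y) hs).
have stop_h s : s <= k -> stop x S s <= dep x.
  by move=> sk; apply: leq_trans (stop_mono _ _ sk) sh.
right; exists (removed x S), (fun s => iter s par x); split.
- exact: removed_closed.
- move=> s sk; rewrite subsetI removed_ball // ?andbT; last exact: ltnW (leq_ltn_trans sk kh).
  by apply/subsetP=> y; rewrite inE => /andP[].
- exact: removed_mono.
apply: leq_trans (sum_removed (f := branch x S) (i := stop x S) _ _) _.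
- by move=> s _; have /andP[] := stopP x S s.
- by move=> s _; have /andP[] := stopP x S s.
apply: leq_sum => s _; apply: card_removed => //; exact: stop_h.
Qed.

End Peeling.

(** * Selecting radii by multiplicative weights *)

Section Covering.

Variables (T : finType) (e : rel T) (par : T -> T) (dep : T -> nat).
Hypothesis rootedT : rooted e par dep.
Variables (q m : nat).

(* Block [b] consists of the [m] radii from [b.+1 * m] on, of which the first
   [x b] are used up; the radius [(q + q).+1 * m] is kept for the last ball. *)
Definition available (x : 'I_(q + q) -> nat) (i : nat) : Prop :=
  i = (q + q).+1 * m \/
  exists b : 'I_(q + q), b.+1 * m + x b <= i < b.+2 * m.

Definition cover_available (x : 'I_(q + q) -> nat) (S : {set T}) : Prop :=
  exists u : nat -> T,
  {in S, forall y, exists i, available x i /\ y \in ball e (u i) i}.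

Variable R : realFieldType.
Local Open Scope ring_scope.

Lemma bernoulli (y : R) (n : nat) : 0 <= y -> 1 + y *+ n <= (1 + y) ^+ n.
Proof.
move=> y0; elim: n => [|n IH]; first by rewrite mulr0n addr0 expr0.
have yn : 0 <= y *+ n by rewrite mulrn_wge0.
rewrite exprS mulrSr; apply: le_trans (ler_wpM2l _ IH); nra.
Qed.

(* Multiplicative weights: block [b] has weight [(1 + d) ^+ x b], and some
   block removes at least its weighted share of the average. *)
Lemma cover_from (d : R) : (0 < q)%N -> (0 < m)%N -> 0 < d ->
  forall (n : nat) (x : 'I_(q + q) -> nat) (S : {set T}) (z0 : T),
  par_closed par S -> (#|S| <= n)%N ->
  (\sum_b (1 + d) ^+ x b) * (1 + d / (3 * q ^ 2 * m)%:R) ^+ #|S| < (1 + d) ^+ m ->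
  cover_available x S.
Proof.
move=> q0 m0 d0; set C := (3 * q ^ 2 * m)%N.
have C0 : 0 < C%:R :> R by rewrite ltr0n /C; lia.
have a1 : 1 <= 1 + d by lra.
have dC : 0 <= d / C%:R by rewrite divr_ge0 ?ltW.
elim=> [|n IH] x S z0 clS Sn smallW.
  exists (fun=> z0) => y; move: Sn; rewrite leqn0 cards_eq0 => /eqP->.
  by rewrite inE.
have [S0|S0] := eqVneq S set0; first by exists (fun=> z0) => y; rewrite S0 inE.
have [[u Su]|[D [u [clD Dball Dmono Dsum]]]] :=
    peel rootedT ((q + q) * m) clS S0.
  exists (fun=> u) => y yS; exists ((q + q).+1 * m)%N; split; first by left.
  by apply: (subsetP (ballS _ _ _)) (subsetP Su y yS); rewrite leq_mul2r leqnSn orbT.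
set W := \sum_b _ in smallW.
(* For k = 2qm the removed sizes add up to at least 3 (qm)^2 = m C, and [sum_blocks] takes off the
   factor m. *)
have CD : (C <= \sum_(b < q + q) #|D (b.+1 * m)%N|)%N.
  rewrite -(leq_pmul2l m0).
  apply: leq_trans (sum_blocks (c := fun s => #|D s|) (m := m) (B := q + q) _); last first.
    by move=> s s' /andP[ss' _]; apply: Dmono.
  apply: leq_trans Dsum.
  have -> : ((q + q) * m = q * m + q * m)%N by rewrite mulnDl.
  apply: leq_trans (sum_minn_double (q * m)).
  by rewrite /C expnMn; apply/eq_leq; ring.
have qq0 : (0 < q + q)%N by rewrite addn_gt0 q0.
pose b0 := Ordinal qq0.
have Wpos b : 0 < (1 + d) ^+ x b by rewrite exprn_gt0 //; lra.
have W0 : 0 < W.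
  rewrite /W.
  rewrite (bigD1 b0) //=; apply: ltr_wpDr (Wpos b0).
  by apply: sumr_ge0 => b _; apply: ltW.
(* Averaging: if every block failed this, summing over [b] would contradict [CD]. *)
have [b bP] : exists b, C%:R * (1 + d) ^+ x b <= W * #|D (b.+1 * m)%N|%:R.
  apply/existsP; rewrite -[X in is_true X]negbK negb_exists; apply/negP=> /forallP lt_b.
  have : W * (\sum_(b < q + q) #|D (b.+1 * m)%N|)%:R < C%:R * W.
    have -> : C%:R * W = \sum_b C%:R * (1 + d) ^+ x b by rewrite mulr_sumr.
    rewrite natr_sum mulr_sumr; apply: ltr_sum => [|b _].
      by apply/hasP; exists b0; rewrite ?mem_index_enum.
    by rewrite ltNge.
  by rewrite mulrC ltr_pM2r // ltr_nat ltnNge CD.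
set c := #|D (b.+1 * m)%N| in bP.
have c0 : (0 < c)%N.
  by rewrite lt0n; apply/eqP=> c0; move: bP; rewrite c0 mulr0 leNgt mulr_gt0.
have bm : (b.+1 * m <= (q + q) * m)%N by rewrite leq_mul2r ltn_ord orbT.
have := Dball _ bm; rewrite subsetI => /andP[DS Db].
have cS : (#|S :\: D (b.+1 * m)%N| + c = #|S|)%N.
  by rewrite cardsD (setIidPr DS) subnK // subset_leq_card.
have E1 : 1 <= (1 + d / C%:R) ^+ #|S| by apply: exprn_ege1; lra.
(* An exhausted block would have weight at least [(1 + d) ^+ m] all by itself. *)
have xm : (x b < m)%N.
  rewrite ltnNge; apply/negP=> mx; move: smallW; rewrite ltNge => /negP; apply.
  apply: (@le_trans _ _ W); last by rewrite ler_peMr // ltW.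
  rewrite /W (bigD1 b) //=; apply: ler_wpDr; last exact: ler_weXn2l.
  by apply: sumr_ge0 => ? _; apply: ltW.
pose x' b' := (x b' + (b' == b))%N.
have [||u' u'P] := IH x' (S :\: D (b.+1 * m)%N) z0 (clD _).
- by move: Sn; rewrite -cS; lia.
(* The total weight grows by [d * (1 + d) ^+ x b], at most [W * d * c / C] by choice of [b]; by
   Bernoulli's inequality the removal of [c] vertices pays for it. *)
- apply: le_lt_trans smallW; rewrite -cS addnC exprD mulrA.
  apply: ler_wpM2r; first by rewrite exprn_ge0 //; lra.
  have -> : \sum_b0 (1 + d) ^+ x' b0 = W + d * (1 + d) ^+ x b.
    rewrite /W (bigD1 b) //= [in RHS](bigD1 b) //= /x' eqxx addn1 exprS.
    rewrite (eq_bigr (fun i => (1 + d) ^+ x i)); first by ring.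
    by move=> i /negPf->; rewrite addn0.
  apply: (@le_trans _ _ (W * (1 + (d / C%:R) *+ c))); last first.
    by rewrite ler_pM2l // bernoulli.
  rewrite mulrDr mulr1 lerD2l -mulr_natr.
  have -> : W * (d / C%:R * c%:R) = (d / C%:R) * (W * c%:R) by ring.
  apply: le_trans (ler_wpM2l dC bP).
  by rewrite mulrA divfK // gt_eqF.
have block (b1 b2 : nat) : (b1 < b2)%N -> (b1.+2 * m <= b2.+1 * m)%N.
  by move=> lt_b; rewrite leq_mul2r !ltnS lt_b orbT.
have bS : (b.+1 * m + x b < b.+2 * m)%N.
  by rewrite [(b.+2 * m)%N]mulSn addnC ltn_add2r.
exists (fun i => if i == (b.+1 * m + x b)%N then u (b.+1 * m)%N else u' i) => y yS.
have [yD|yD] := boolP (y \in D (b.+1 * m)%N).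
  exists (b.+1 * m + x b)%N; split; last first.
    by rewrite eqxx; apply: (subsetP (ballS _ _ _)) (subsetP Db y yD); apply: leq_addr.
  by right; exists b; rewrite leqnn bS.
have [|i [av yi]] := u'P y; first by rewrite inE yD.
exists i; case: eqP => [ii|_]; last first.
  split=> //; case: av => [->|[b' b'P]]; [by left|right; exists b'].
  case/andP: b'P => le_i ->; rewrite andbT; apply: leq_trans le_i.
  by rewrite leq_add2l leq_addr.
(* The radius just used is no longer available under [x']: it is not the reserved one, and the
   blocks are disjoint. *)
exfalso; case: av => [|[b']]; rewrite ii.
  by move=> ib; move: bS; rewrite ib ltn_mul2r m0 /= !ltnS leqNgt ltn_ord.
rewrite /x'; case: eqP => [->|/eqP bb]; first by rewrite leq_add2l addn1 ltnn.
case/andP=> ge_i lt_i; move: bb; rewrite -val_eqE /= neq_ltn => /orP[] /block.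
  by move/(leq_trans lt_i); rewrite ltnNge leq_addr.
move/(leq_trans bS); rewrite ltnNge => /negP; apply.
exact: leq_trans (leq_addr _ _) ge_i.
Qed.

End Covering.

(** * Rooting a tree and counting its degrees *)

Section Trees.

Variables (T : finType) (e : rel T).

Lemma connect_ball (r y : T) : connect e r y -> exists k, y \in ball e r k.
Proof.
case/connectP=> s; elim/last_ind: s y => [|s z IH] y /=.
  by move=> _ ->; exists 0; rewrite inE.
rewrite rcons_path last_rcons => /andP[ps ez] ->.
by have [k /ball_step] := IH _ ps erefl => /(_ z ez); exists k.+1.
Qed.

(** Breadth-first search: [dep] is the distance from [r], and the parent is a neighbour one step
    nearer to [r]. *)
Lemma rooted_exists (r : T) :
  symmetric e -> (forall y, connect e r y) ->
  exists par dep, rooted e par dep /\ dep r = 0.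
Proof.
move=> e_sym con; have ex y : exists k, y \in ball e r k by apply: connect_ball.
pose dep y := ex_minn (ex y).
have depP y : y \in ball e r (dep y) by rewrite /dep; case: ex_minnP.
have dep_min y k : y \in ball e r k -> dep y <= k.
  by rewrite /dep; case: ex_minnP => m _; apply.
have parent y : exists z, (dep y == 0) && (z == y) || (dep z == (dep y).-1) && e z y.
  case dy: (dep y) => [|d]; first by exists y; rewrite !eqxx.
  have := depP y; rewrite dy /= !inE => /orP[/dep_min|]; first by rewrite dy ltnn.
  case/existsP=> z /andP[zd ezy]; exists z; rewrite ezy andbT /= eqn_leq dep_min //=.
  by rewrite -ltnS -dy; apply: dep_min; apply: ball_step (depP z) ezy.
exists (fun y => xchoose (parent y)), dep; split; last first.
  by apply/eqP; rewrite -leqn0 dep_min // inE.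
split=> [x y x0 y0|y|y y0].
- by have := depP x; have := depP y; rewrite x0 y0 !inE => /eqP-> /eqP->.
- by case/orP: (xchooseP (parent y)) => /andP[/eqP dz]; [move=> /eqP->; rewrite dz|].
- case/orP: (xchooseP (parent y)) => /andP[/eqP dz]; first by rewrite dz in y0.
  by move=> ez; rewrite [e y _]e_sym ez.
Qed.

Variables (par : T -> T) (dep : T -> nat).
Hypothesis rootedT : rooted e par dep.

Let root_uniq : forall x y, dep x = 0 -> dep y = 0 -> x = y.
Proof. by case: rootedT. Qed.

Let dep_par : forall y, dep (par y) = (dep y).-1.
Proof. by case: rootedT. Qed.

Let e_par : forall y, 0 < dep y -> e (par y) y && e y (par y).
Proof. by case: rootedT. Qed.

Definition par_edge (x y : T) : bool :=
  (0 < dep x) && (y == par x) || (0 < dep y) && (x == par y).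

Lemma par_edge_sym : symmetric par_edge.
Proof. by move=> x y; rewrite /par_edge orbC. Qed.

Lemma par_edge_connect (x y : T) : connect par_edge x y.
Proof.
have to_root z : connect par_edge z (iter (dep z) par z).
  have: forall a, connect par_edge z (iter a par z).
    elim=> //= a IH; apply: connect_trans IH _.
    have [z0|z0] := posnP (dep (iter a par z)).
      by rewrite (par_root rootedT).
    by apply: connect1; rewrite /par_edge z0 eqxx.
  exact.
apply: connect_trans (to_root x) _.
rewrite (sym_connect_sym par_edge_sym).
have -> : iter (dep x) par x = iter (dep y) par y.
  by apply: root_uniq; rewrite (dep_iter_par rootedT) subnn.
exact: to_root.
Qed.

(** Any other edge would close a path of parent edges to a cycle of length at least 3. *)
Lemma edge_par_edge (x y : T) :
  simple_graph e -> acyclic e -> e x y -> par_edge x y.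
Proof.
move=> [e_sym e_irr] acy exy; apply/negPn/negP=> npxy.
have /connectP[s ps ys] := par_edge_connect x y.
case/shortenP: ps ys => s' ps' us' _ ys.
have sub : subrel par_edge e.
  move=> u v /orP[] /andP[u0 /eqP->]; first by case/andP: (e_par u0).
  by case/andP: (e_par u0).
have := acy (x :: s'); rewrite /ucycle us' /= rcons_path (sub_path sub ps') /= -ys.
rewrite e_sym exy => /(_ isT).
case: s' ps' ys {us'} => [|z [|]] //=; first by move=> _ yx; rewrite -yx e_irr in exy.
by rewrite andbT => pxz yz; rewrite -yz (negPf npxy) in pxz.
Qed.

(** The neighbours of a vertex are its parent, absent at the root, and its children; each vertex but
    the root is a child once. *)
Lemma sum_degree_tree (r : T) :
  simple_graph e -> acyclic e -> dep r = 0 ->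
  \sum_x degree e x <= 2 * #|T|.-1.
Proof.
move=> sg acy r0.
have deg x : degree e x <= (x != r) + \sum_(y | y != r) (par y == x).
  have sub : [set y | e x y] \subset
      [set y | (x != r) && (y == par x)] :|: [set y | (y != r) && (par y == x)].
    apply/subsetP=> y; rewrite !inE => /(edge_par_edge sg acy).
    have ne_r z : 0 < dep z -> z != r by apply: contraTneq => ->; rewrite r0.
    case/orP=> /andP[/ne_r -> /eqP->]; first by rewrite eqxx.
    by rewrite eqxx orbT.
  apply: leq_trans (subset_leq_card sub) _; apply: leq_trans (leq_card_setU _ _).1 _.
  apply: leq_add.
    case: (x != r) => /=; last by rewrite eq_card0 // => y; rewrite inE.
    by rewrite (_ : [set _ | _] = [set par x]) ?cards1 //; apply/setP=> y; rewrite !inE.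
  rewrite -sum1_card big_mkcond [leqRHS]big_mkcond /=.
  by apply: leq_sum => y _; rewrite inE; case: (y != r) => //=; case: (_ == _).
apply: (@leq_trans (\sum_x ((x != r) + \sum_(y | y != r) (par y == x)))).
  by apply: leq_sum => x _; apply: deg.
rewrite big_split /= exchange_big /=.
have -> : \sum_(y | y != r) \sum_x (par y == x) = \sum_(y | y != r) 1.
  apply: eq_bigr => y _; rewrite (bigD1 (par y)) //= eqxx big1 ?addn0 // => x.
  by rewrite eq_sym => /negPf->.
have -> : \sum_x (x != r) = \sum_(x | x != r) 1.
  by rewrite [RHS]big_mkcond /=; apply: eq_bigr => x _; case: (x != r).
have -> : \sum_(x | x != r) 1 = #|T|.-1.
  rewrite sum1_card -[in RHS]cardsT (cardsD1 r) in_setT.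
  by apply: eq_card => y; rewrite !inE andbT.
by rewrite mul2n addnn.
Qed.

Lemma card_leaf_nonleaf : #|T| = #|[set x | leaf e x]| + num_nonleaf e.
Proof.
rewrite /num_nonleaf -(cardsC [set x | leaf e x]); congr (_ + _).
by apply: eq_card => x; rewrite !inE.
Qed.

(** Away from the root, the degree plus 2 for a leaf and 1 for degree 2 is at least 3. The extra 3
    granted to the root covers a one-vertex tree, at the price of the final [+ 1]. *)
Lemma num_nonleaf_le (r : T) :
  simple_graph e -> acyclic e -> dep r = 0 ->
  2 * num_nonleaf e <= #|T| + num_deg2 e + 1.
Proof.
move=> sg acy r0; have sd := sum_degree_tree sg acy r0.
have ge3 x : 3 <= degree e x + 2 * leaf e x + (degree e x == 2) + 3 * (x == r).
  have [->|xr] := eqVneq x r; first by lia.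
  have : 0 < degree e x.
    have x0 : 0 < dep x.
      by rewrite lt0n; apply: contra xr => /eqP x0; apply/eqP/root_uniq.
    by apply/card_gt0P; exists (par x); rewrite inE; case/andP: (e_par x0).
  rewrite /leaf; lia.
have sum3 : 3 * #|T| <= \sum_x
    (degree e x + 2 * leaf e x + (degree e x == 2) + 3 * (x == r)).
  by rewrite mulnC -sum_nat_const; apply: leq_sum => x _; apply: ge3.
have count (P : pred T) : \sum_x P x = #|[set x | P x]|.
  rewrite -sum1_card [RHS]big_mkcond /=.
  by apply: eq_bigr => x _; rewrite inE; case: (P x).
move: sum3; rewrite !big_split /= !count !big1_eq -/(num_deg2 e).
have -> : #|[set x | x == r]| = 1.
  by rewrite -(cards1 r); apply: eq_card => x; rewrite !inE.
have := card_leaf_nonleaf.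
move: sd; set d := \sum_x _; move: #|[set x | leaf e x]| #|T| d => a b d; lia.
Qed.

(** A parent other than the root has two neighbours, its child and its own parent. So rooting at a
    non-leaf makes the non-leaves ancestor-closed. *)
Lemma par_nonleaf (r y : T) : dep r = 0 -> ~~ leaf e r -> ~~ leaf e (par y).
Proof.
move=> r0 rl; have [y0|p0] := posnP (dep (par y)).
  by rewrite (root_uniq y0 r0).
have dy : 0 < dep y by move: p0; rewrite dep_par; lia.
apply/negP=> /cards1P[z nz].
have /andP[e1 _] := e_par dy; have /andP[_ e2] := e_par p0.
have : par (par y) \in [set z] by rewrite -nz inE.
have : y \in [set z] by rewrite -nz inE.
by rewrite !inE => /eqP <- /eqP/(congr1 dep); rewrite !dep_par; lia.
Qed.

End Trees.

(** * Numerical estimates *)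

Section Weights.

Variable R : realFieldType.
Local Open Scope ring_scope.

(** A converse to Bernoulli's inequality: an upper bound 1 / (1 - n y) for the power, free of
    division. *)
Lemma expr1D_mul_le1 (y : R) (n : nat) :
  0 <= y -> (1 + y) ^+ n * (1 - y *+ n) <= 1.
Proof.
move=> y0; elim: n => [|n IH]; first by rewrite expr0 mulr0n subr0 mulr1.
apply: le_trans IH; rewrite exprSr -mulrA ler_wpM2l ?exprn_ge0 //; first by lra.
have yn : 0 <= y *+ n by rewrite mulrn_wge0.
rewrite mulrSr; nra.
Qed.

(** The starting condition of [cover_from] for d = 1/q and m = qt. The slack in [q - 2] leaves a
    factor of at least (1 + 1/q^2)^m >= 1 + t/q, which exceeds the number 2q of blocks. *)
Lemma initial_weight (q t n : nat) :
  (2 < q)%N -> (2 * q ^ 2 <= t)%N ->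
  (n <= (3 * q ^ 2 * (q - 2) * t) * (q * t))%N ->
  (q + q)%:R * (1 + q%:R^-1 / (3 * q ^ 2 * (q * t))%:R) ^+ n <
  (1 + q%:R^-1) ^+ (q * t) :> R.
Proof.
move=> q2 qt nN; set N := (3 * _ * _ * t)%N in nN; set m := (q * t)%N in nN *.
have t0 : (0 < t)%N by nia.
have Q0 : 0 < q%:R :> R by rewrite ltr0n; lia.
have T0 : 0 < t%:R :> R by rewrite ltr0n.
set w := q%:R^-1 : R; have w0 : 0 < w by rewrite invr_gt0.
set y := w / _.
have y0 : 0 <= y by rewrite divr_ge0 ?ler0n // ltW.
have w1 : w <= 1 by rewrite invf_le1 // ler1n; lia.
have wq : w * q%:R = 1 by rewrite mulVf // gt_eqF.
have yN : y *+ N = w - 2 * w ^+ 2.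
  rewrite -mulr_natr /y /N /m !natrM natrB ?(ltnW q2) // !expr2 /w.
  by field; rewrite !gt_eqF.
set E := 1 + y; have E1 : 1 <= E by rewrite /E; lra.
set b := 1 - y *+ N; have b0 : 0 < b by rewrite /b yN; nra.
have EN : E ^+ N * b <= 1 by apply: expr1D_mul_le1.
(* The product equals 1 + w^2 + 2 w^3. *)
have ab : 1 + w ^+ 2 <= (1 + w) * b by rewrite /b yN; nra.
have lt_m : (q + q)%:R < ((1 + w) * b) ^+ m.
  have w20 : 0 <= w ^+ 2 by rewrite exprn_ge0 // ltW.
  apply: lt_le_trans (lerXn2r m _ _ ab); rewrite ?nnegrE; [|lra|nra].
  apply: lt_le_trans (bernoulli m w20).
  have -> : w ^+ 2 *+ m = w * t%:R.
    by rewrite -mulr_natr /m natrM mulrA expr2 -[w * w * _]mulrA wq mulr1.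
  have : (2 * q ^ 2)%:R <= t%:R :> R by rewrite ler_nat.
  move/(ler_wpM2l (ltW w0)); rewrite natrM natrX expr2.
  have -> : w * (2%:R * (q%:R * q%:R)) = (w * q%:R) * (q%:R + q%:R) by ring.
  by rewrite wq natrD; lra.
rewrite -(ltr_pM2r (exprn_gt0 m b0)) -exprMn; apply: le_lt_trans lt_m.
rewrite -[leRHS]mulr1 -mulrA; apply: ler_wpM2l; first exact: ler0n.
apply: (@le_trans _ _ ((E ^+ N * b) ^+ m)); last first.
  by apply: exprn_ile1 => //; rewrite mulr_ge0 ?exprn_ge0 ?ltW //; lra.
rewrite exprMn -exprM; apply: ler_wpM2r; first by rewrite exprn_ge0 // ltW.
exact: ler_weXn2l.
Qed.

(** The difference of the two sides is quadratic in [s] with leading coefficient Q^2 (b - a^2); the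
    hypothesis, multiplied by [s], lets this term dominate the others. *)
Lemma quadratic_gap (Q a b s : R) :
  0 <= b -> 1 <= s -> 2 * Q ^+ 2 * b + 4 * Q * a + 5 <= s * (Q ^+ 2 * (b - a ^+ 2)) ->
  (a * (Q * s) + 2) ^+ 2 <= Q ^+ 2 * b * (s - 1) ^+ 2 - 1.
Proof.
move=> b0 s1 big_s; have s0 : 0 <= s by lra.
have Qb : 0 <= Q ^+ 2 * b by rewrite mulr_ge0 // sqr_ge0.
by move: big_s; rewrite -subr_ge0 => /(mulr_ge0 s0); lra.
Qed.

End Weights.

(** * Burning trees with few vertices of degree 2 *)

Lemma burning_number_tree (T : finType) (e : rel T) (q t : nat) :
  tree e -> (2 < q)%N -> (2 * q ^ 2 <= t)%N -> (0 < num_nonleaf e)%N ->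
  (num_nonleaf e <= (3 * q ^ 2 * (q - 2) * t) * (q * t))%N ->
  (burning_number e <= (q + q).+1 * (q * t) + 2)%N.
Proof.
move=> [[e_sym _] [_ con] _] q2 qt /card_gt0P[r]; rewrite inE => rl small.
have [par [dep [rootedT r0]]] := rooted_exists e_sym (con r).
have t0 : (0 < t)%N by nia.
have q0 : (0 < q)%N by lia.
have m0 : (0 < q * t)%N by rewrite muln_gt0 q0.
have d0 : (0 < q%:R^-1 :> rat)%R by rewrite invr_gt0 ltr0n.
have [||u uP] := cover_from rootedT q0 m0 d0 (x := fun=> 0)
  (S := [set x | ~~ leaf e x]) r _ (leqnn _).
- by move=> y _; rewrite inE (par_nonleaf rootedT _ r0).
- rewrite sumr_const card_ord expr0; exact: initial_weight.
(* Each ball grows by one to reach from the parent of [y] to [y]. This and the start of the radii at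
   0 account for the summand 2. *)
apply: (burning_number_le_cover (u := fun i => u i.-1)) => y.
have [|i [av yi]] := uP (par y); first by rewrite inE (par_nonleaf rootedT _ r0).
exists i.+1; last exact: (ball_iter_down rootedT (a := 1)).
rewrite addn2 !ltnS; case: av => [-> //|[b /andP[_ /ltnW]]] /leq_trans; apply.
by rewrite leq_mul2r ltnS ltn_ord orbT.
Qed.

Lemma num_nonleaf_le_tree (T : finType) (e : rel T) :
  tree e -> 2 * num_nonleaf e <= #|T| + num_deg2 e + 1.
Proof.
move=> [sg [/card_gt0P[r _] con] acy].
have [par [dep [rootedT r0]]] := rooted_exists sg.1 (con r).
exact: (num_nonleaf_le rootedT sg acy r0).
Qed.

Theorem theorem10 (R : realType) (p : R) (hp : (0 <= p < 2%:R / 3%:R)%R) :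
  exists N : nat, 0 < N /\
    forall (T : finType) (e : rel T),
      in_class e p -> N <= num_nonleaf e -> well_burnable e R.
Proof.
case/andP: hp => p0 p1; set g : R := (2 - 3 * p)%R.
have g0 : (0 < g)%R by rewrite /g; lra.
(* The 17 serves [ba] below, where b - a^2 = g Q^2 - (16 - 6p) Q - 1. *)
pose q := (3 + Num.truncn (17 / g)).+1.
have qg : (17 < q%:R * g)%R.
  rewrite -ltr_pdivrMr //; apply: lt_le_trans (truncnS_gt _) _.
  by rewrite ler_nat ltnS leq_addl.
have q2 : 2 < q by [].
set Q : R := (q%:R)%R in qg.
have Q3 : (3 <= Q)%R by rewrite /Q ler_nat.
(* With [t] as chosen below, there are at most a Q t + 2 rounds and at least Q^2 b (t - 1)^2 - 1
   vertices, so b > a^2 suffices for large [t]. *)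
pose b : R := (3 * (2 - p) * Q * (Q - 2))%R; pose a : R := (2 * Q + 1)%R.
have ba : (0 < b - a ^+ 2)%R.
  by rewrite /b /a; move: qg; rewrite /g; nra.
have b0 : (0 <= b)%R by have := sqr_ge0 a; lra.
have Q2 : (0 < Q ^+ 2 * (b - a ^+ 2))%R by rewrite mulr_gt0 // exprn_gt0 //; lra.
pose c : R := (2 * Q ^+ 2 * b + 4 * Q * a + 5)%R.
pose t1 := maxn (Num.truncn (c / (Q ^+ 2 * (b - a ^+ 2)))).+1 (2 * q ^ 2).
pose A := 3 * q ^ 2 * (q - 2) * q.
(* This many non-leaves force t > t1 for the least [t] with [num_nonleaf e <= A * t ^ 2]; minimality
   also gives the lower bound with [t.-1]. *)
exists (A * t1 ^ 2).+1; split=> // T e [treeT pE] large.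
have ex_t : exists t, num_nonleaf e <= A * t ^ 2.
  by exists (num_nonleaf e); rewrite /A; nia.
case: (ex_minnP ex_t) => t small min_t.
have t1t : t1 < t.
  rewrite ltnNge; apply/negP=> tt1; move: (leq_trans large small).
  by rewrite ltnNge leq_mul2l leq_exp2r // tt1 orbT.
have qt : 2 * q ^ 2 <= t by apply: leq_trans (ltnW t1t); apply: leq_maxr.
have n0 : 0 < num_nonleaf e by apply: leq_trans large.
have big_t : (c <= t%:R * (Q ^+ 2 * (b - a ^+ 2)))%R.
  rewrite -ler_pdivrMr // ltW //; apply: lt_le_trans (truncnS_gt _) _.
  by rewrite ler_nat; apply: leq_trans (ltnW t1t); apply: leq_maxl.
have lower : A * t.-1 ^ 2 < num_nonleaf e.
  by rewrite ltnNge; apply/negP=> /min_t; lia.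
have small' : num_nonleaf e <= (3 * q ^ 2 * (q - 2) * t) * (q * t).
  by apply: leq_trans small _; apply/eq_leq; rewrite /A; ring.
have bn := burning_number_tree treeT q2 qt n0 small'.
have nl := num_nonleaf_le_tree treeT.
rewrite /well_burnable; set K := (q + q).+1 * (q * t) + 2 in bn.
apply: (@le_trans _ _ (K%:Z)%R); first by rewrite lez_nat.
suff KT : (K%:R ^+ 2 <= #|T|%:R :> R)%R.
  have KS : (K%:R <= Num.sqrt (#|T|%:R) :> R)%R.
    by rewrite -[leLHS]ger0_norm ?ler0n // -sqrtr_sqr ler_wsqrtr.
  have := le_ceil KS; rewrite -[(K%:R)%R]/((K%:Z)%:~R)%R intrKceil.
  exact.
have n2 : ((num_deg2 e)%:R = p * (num_nonleaf e)%:R :> R)%R.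
  by rewrite -pE divfK // pnatr_eq0 -lt0n.
have nl' : (2 * (num_nonleaf e)%:R <= #|T|%:R + (num_deg2 e)%:R + 1 :> R)%R.
  by move: nl; rewrite -(ler_nat R) natrM 2!natrD.
have lower' : ((Q * Q * Q * 3 * (Q - 2)) * (t%:R - 1) ^+ 2 <= (num_nonleaf e)%:R)%R.
  have <- : ((A * t.-1 ^ 2)%N%:R = (Q * Q * Q * 3 * (Q - 2)) * (t%:R - 1) ^+ 2 :> R)%R.
    have -> : (t%:R - 1 = t.-1%:R :> R)%R.
      by rewrite -[in LHS](prednK (leq_ltn_trans (leq0n _) t1t)) -addn1 natrD addrK.
    by rewrite /A !natrM natrB // !expr2 /Q; ring.
  by rewrite ler_nat ltnW.
have KE : (K%:R = a * (Q * t%:R) + 2 :> R)%R.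
  by rewrite /K natrD natrM natrM -addn1 !natrD /a /Q; ring.
have t1R : (1 <= t%:R :> R)%R by rewrite ler1n; lia.
rewrite KE; apply: (@le_trans _ _ (Q ^+ 2 * b * (t%:R - 1) ^+ 2 - 1)%R).
  exact: quadratic_gap.
have : ((2 - p) * (num_nonleaf e)%:R - 1 <= #|T|%:R :> R)%R by lra.
apply: le_trans; rewrite lerD2r.
have -> : (Q ^+ 2 * b * (t%:R - 1) ^+ 2 =
  (2 - p) * (Q * Q * Q * 3 * (Q - 2) * (t%:R - 1) ^+ 2))%R by rewrite /b; ring.
by apply: ler_wpM2l lower'; lra.
Qed.
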